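(* Let $V$ be a finite set (the pixels of an image), let $d\ge 1$ be an integer, let $I:V\to\mathbb{R}^d$ be a function (the appearance of each pixel), and let $\sigma>0$. Let $G_{\mathrm{data}}$ be the fully connected weighted graph on $V$ with weights $w(i,j)=\exp\left(-\frac{\|I(i)-I(j)\|^2}{2\sigma^2}\right)$ for all $i,j\in V$. Then for every partition $(A,B)$ of $V$ into two disjoint nonempty sets, $$\operatorname{NCut}(A,B\mid G_{\mathrm{data}})=\langle g_V,g_V\rangle\,\frac{\langle g_A,g_B\rangle}{\langle g_A,g_V\rangle\,\langle g_B,g_V\rangle},$$ where, for nonempty $S\subseteq V$, $g_S$ is the Gaussian kernel density estimate of the values of $I$ on $S$ with kernel $K(u)=(\pi\sigma^2)^{-d/2}\exp\left(-\|u\|^2/\sigma^2\right)$.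
   Context: $\|\cdot\|$ is the Euclidean norm on $\mathbb{R}^d$. For a weighted graph $G$ on vertex set $V$ with symmetric weights $w$, and a partition $(A,B)$ of $V$: $\operatorname{Cut}(A,B\mid G)=\sum_{i\in A,\,j\in B}w(i,j)$; for $S\subseteq V$, $\operatorname{Vol}(S\mid G)=\sum_{i\in S,\,j\in V}w(i,j)$, where for $G_{\mathrm{data}}$ the terms with $i=j$ are included, with $w(i,i)=1$ as given by the weight formula; and the normalized cut is $$\operatorname{NCut}(A,B\mid G)=\frac{\operatorname{Cut}(A,B\mid G)}{\operatorname{Vol}(A\mid G)}+\frac{\operatorname{Cut}(A,B\mid G)}{\operatorname{Vol}(B\mid G)}.$$ For nonempty $S\subseteq V$, the kernel density estimate is the function $g_S:\mathbb{R}^d\to\mathbb{R}$, $g_S(c)=\frac{1}{|S|}\sum_{i\in S}K(I(i)-c)$, where $K:\mathbb{R}^d\to\mathbb{R}$, $K(u)=\left(\frac{1}{\pi\sigma^2}\right)^{d/2}\exp\left(-\frac{\|u\|^2}{\sigma^2}\right)$ is the Gaussian density with mean $0$ and covariance $\frac{\sigma^2}{2}\,\mathrm{Id}$. The inner product is the standard one, $\langle f,g\rangle=\int_{\mathbb{R}^d}f(c)g(c)\,\mathrm{d}c$. *)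

(* Defs.v *)
From HB Require Import structures.
From mathcomp Require Import all_boot all_order all_algebra.
From mathcomp Require Import all_classical all_reals all_analysis.

Set Implicit Arguments.
Unset Strict Implicit.
Unset Printing Implicit Defensive.

Import Order.TTheory GRing.Theory Num.Theory.
Import numFieldNormedType.Exports.

Local Open Scope classical_set_scope.
Local Open Scope ring_scope.

Definition measure_row_display : measure_display.
Proof. exact: default_measure_display. Qed.

Section measurable_row.
Context {R : realType} (n : nat).

Let coors : 'I_n -> 'rV[R]_n -> measurableTypeR R := fun i x => x ord0 i.

Let row_set0 : g_sigma_preimage coors set0.
Proof. exact: sigma_algebra0. Qed.

Let row_setC A : g_sigma_preimage coors A -> g_sigma_preimage coors (~` A).
Proof. exact: sigma_algebraC. Qed.

Let row_bigcup (F : _^nat) : (forall i, g_sigma_preimage coors (F i)) ->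
  g_sigma_preimage coors (\bigcup_i (F i)).
Proof. exact: sigma_algebra_bigcup. Qed.

(* The product (= Borel) sigma-algebra on R^n, generated by the coordinates. *)
HB.instance Definition _ := @isMeasurable.Build measure_row_display
  'rV[R]_n (g_sigma_preimage coors) row_set0 row_setC row_bigcup.

Lemma measurable_row_coord (i : 'I_n) :
  measurable_fun [set: 'rV[R]_n] (fun x => x ord0 i : measurableTypeR R).
Proof.
move=> _ Y mY; rewrite setTI; apply: sub_sigma_algebra => /=.
rewrite -bigcup_seq/=; exists i => /=; first by rewrite mem_index_enum.
by exists Y => //; rewrite setTI.
Qed.

Lemma measurable_fun_rowP d (T : measurableType d) (f : T -> 'rV[R]_n) :
  measurable_fun [set: T] f <->
  forall i, measurable_fun [set: T] (fun x => f x ord0 i : measurableTypeR R).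
Proof.
split=> [mf i|mf].
  exact: (measurableT_comp (measurable_row_coord i) mf).
move=> _ A mA; rewrite setTI.
suff : g_sigma_preimage (fun i x => f x ord0 i : measurableTypeR R)
    `<=` measurable.
  apply; rewrite (g_sigma_preimage_comp coors f).
  by exists A => //; rewrite setTI.
apply: smallest_sub; first exact: sigma_algebra_measurable.
move=> B; rewrite -bigcup_seq/= => -[i _ [C mC <-]].
exact: mf.
Qed.

End measurable_row.

Definition row_cons {R : realType} {n : nat}
    (p : measurableTypeR R * 'rV[R]_n) : 'rV[R]_n.+1 :=
  row_mx (const_mx p.1 : 'rV[R]_1) p.2.

Lemma row_cons0 {R : realType} {n : nat} (p : measurableTypeR R * 'rV[R]_n) :
  row_cons p ord0 ord0 = p.1.
Proof.
rewrite /row_cons (_ : ord0 = lshift n (ord0 : 'I_1)); last exact: val_inj.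
by rewrite (@row_mxEl _ 1 1 n) mxE.
Qed.

Lemma row_consS {R : realType} {n : nat} (p : measurableTypeR R * 'rV[R]_n)
  (i : 'I_n) : row_cons p ord0 (lift ord0 i) = p.2 ord0 i.
Proof.
rewrite /row_cons (_ : lift ord0 i = rshift 1 i); last exact: val_inj.
by rewrite (@row_mxEr _ 1 1 n).
Qed.

Lemma measurable_row_cons {R : realType} {n : nat} :
  measurable_fun [set: measurableTypeR R * 'rV[R]_n] row_cons.
Proof.
apply/measurable_fun_rowP => i; have [j ->|->] := unliftP ord0 i.
  under eq_fun do rewrite row_consS.
  exact: (measurableT_comp (measurable_row_coord j) measurable_snd).
under eq_fun do rewrite row_cons0.
exact: measurable_fst.
Qed.

HB.instance Definition _ (R : realType) (n : nat) :=
  isMeasurableFun.Build _ _ _ _ (@row_cons R n) measurable_row_cons.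

Definition row_uncons {R : realType} {n : nat} (x : 'rV[R]_n.+1) :
    measurableTypeR R * 'rV[R]_n :=
  (x ord0 ord0, \row_i x ord0 (lift ord0 i)).

Lemma row_consK {R : realType} {n : nat} :
  cancel (@row_cons R n) row_uncons.
Proof.
move=> [a x]; congr pair; rewrite /= ?row_cons0//.
by apply/rowP => i; rewrite mxE row_consS.
Qed.

Lemma row_unconsK {R : realType} {n : nat} :
  cancel (@row_uncons R n) row_cons.
Proof.
move=> x; apply/rowP => i; have [j ->|->] := unliftP ord0 i.
  by rewrite row_consS mxE.
by rewrite row_cons0.
Qed.

Lemma measurable_row_uncons {R : realType} {n : nat} :
  measurable_fun [set: 'rV[R]_n.+1] row_uncons.
Proof.
apply/measurable_fun_pair; first exact: measurable_row_coord.
apply/measurable_fun_rowP => i; under eq_fun do rewrite mxE.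
exact: measurable_row_coord.
Qed.

Section lebesgue_cons.
Context {R : realType} (n : nat).
Variable mu : {sigma_finite_measure set 'rV[R]_n -> \bar R}.

Definition lebesgue_cons : set 'rV[R]_n.+1 -> \bar R :=
  pushforward (lebesgue_measure \x mu)%E row_cons.

Let lebesgue_cons0 : lebesgue_cons set0 = 0%E.
Proof. exact: measure0. Qed.

Let lebesgue_cons_ge0 A : (0 <= lebesgue_cons A)%E.
Proof. exact: measure_ge0. Qed.

Let lebesgue_cons_sigma_additive : semi_sigma_additive lebesgue_cons.
Proof. exact: measure_semi_sigma_additive. Qed.

HB.instance Definition _ := isMeasure.Build _ _ _ lebesgue_cons
  lebesgue_cons0 lebesgue_cons_ge0 lebesgue_cons_sigma_additive.

Let lebesgue_cons_sigma_finite : sigma_finite setT lebesgue_cons.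
Proof.
have /sigma_finiteP[F [TF ndF Foo]] := sigma_finiteT (@lebesgue_measure R).
have /sigma_finiteP[G [TG ndG Goo]] := sigma_finiteT mu.
exists (fun k => row_uncons @^-1` (F k `*` G k)).
  apply/seteqP; split=> // x _.
  have [i _ Fx] : (\bigcup_i F i) (row_uncons x).1 by rewrite -TF.
  have [j _ Gx] : (\bigcup_i G i) (row_uncons x).2 by rewrite -TG.
  exists (maxn i j) => //; split.
    by move: Fx; exact/subsetPset/ndF/leq_maxl.
  by move: Gx; exact/subsetPset/ndG/leq_maxr.
move=> k; have [mF Fk] := Foo k; have [mG Gk] := Goo k; split.
  rewrite -[X in measurable X]setTI.
  by apply: measurable_row_uncons => //; exact: measurableX.
rewrite /lebesgue_cons /pushforward -comp_preimage.
rewrite (_ : row_uncons \o row_cons = id) ?preimage_id; last first.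
  by apply/funext => p /=; rewrite row_consK.
by rewrite product_measure1E// lte_mul_pinfty// ge0_fin_numE.
Qed.

HB.instance Definition _ := Measure_isSigmaFinite.Build _ _ _ lebesgue_cons
  lebesgue_cons_sigma_finite.

End lebesgue_cons.

(* Lebesgue measure on R^n, as the n-fold product of lebesgue_measure; R^0 is a
   point of mass 1. *)
Fixpoint lebesgue_row {R : realType} (n : nat) :
    {sigma_finite_measure set 'rV[R]_n -> \bar R} :=
  match n with
  | 0%N => dirac (0 : 'rV[R]_0)
  | n'.+1 => lebesgue_cons (lebesgue_row n')
  end.

Lemma lebesgue_row_box (R : realType) (n : nat)
    (A : 'I_n -> set (measurableTypeR R)) :
  (forall i, measurable (A i)) ->
  lebesgue_row n [set x | forall i, A i (x ord0 i)] =
  (\prod_(i < n) lebesgue_measure (A i))%E.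
Proof.
elim: n A => [|n IHn] A mA.
  by rewrite big_ord0 /= /dirac indicE mem_set// => -[].
rewrite big_ord_recl /= -IHn//.
have mB : measurable [set x : 'rV[R]_n | forall i, A (lift ord0 i) (x ord0 i)].
  rewrite (_ : mkset _ = \bigcap_(i in [set: 'I_n])
      ((fun x : 'rV[R]_n => x ord0 i : measurableTypeR R) @^-1`
       A (lift ord0 i))); last first.
    by apply/seteqP; split=> x /= h i; [move=> _|]; exact: h.
  apply: fin_bigcap_measurable => // i _.
  by rewrite -[X in measurable X]setTI; exact: measurable_row_coord.
rewrite -product_measure1E// /lebesgue_cons /pushforward; congr (_ _).
apply/seteqP; split=> [p /= h|p /= [h0 h] i].
  split; first by have := h ord0; rewrite row_cons0.
  by move=> i; have := h (lift ord0 i); rewrite row_consS.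
by have [j ->|->] := unliftP ord0 i; rewrite ?row_consS ?row_cons0.
Qed.

(* The Euclidean norm; the norm `|u| on matrices is the sup norm. *)
Definition norm2 {R : realType} {d : nat} (u : 'rV[R]_d) : R :=
  Num.sqrt (\sum_(i < d) u ord0 i ^+ 2).

(* Pitfall: the real-valued integral is 0 when the extended-real one is
   infinite; this does not occur for products of Gaussian sums. *)
Definition innerL2 {R : realType} {d : nat} (f g : 'rV[R]_d -> R) : R :=
  \int[lebesgue_row d]_c (f c * g c).

(* Diagonal entries weight i i are allowed and are counted by Vol. *)
Record wgraph (R : realType) (V : finType) := WGraph {
  weight :> V -> V -> R;
  weight_sym : forall i j, weight i j = weight j i }.

Definition Cut {R : realType} {V : finType} (G : wgraph R V)
    (A B : {set V}) : R :=
  \sum_(i in A) \sum_(j in B) G i j.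

Definition Vol {R : realType} {V : finType} (G : wgraph R V)
    (S : {set V}) : R :=
  \sum_(i in S) \sum_(j : V) G i j.

Definition NCut {R : realType} {V : finType} (G : wgraph R V)
    (A B : {set V}) : R :=
  Cut G A B / Vol G A + Cut G A B / Vol G B.

Definition data_weight {R : realType} {V : finType} {d : nat}
    (I : V -> 'rV[R]_d) (sigma : R) (i j : V) : R :=
  expR (- (norm2 (I i - I j) ^+ 2 / (2 * sigma ^+ 2))).

Lemma data_weight_sym (R : realType) (V : finType) (d : nat)
    (I : V -> 'rV[R]_d) (sigma : R) (i j : V) :
  data_weight I sigma i j = data_weight I sigma j i.
Proof.
rewrite /data_weight; suff -> : norm2 (I i - I j) = norm2 (I j - I i) by [].
rewrite /norm2 -(opprB (I j)); congr Num.sqrt.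
by apply: eq_bigr => k _; rewrite [X in X ^+ 2]mxE sqrrN.
Qed.

Definition Gdata {R : realType} {V : finType} {d : nat}
    (I : V -> 'rV[R]_d) (sigma : R) : wgraph R V :=
  WGraph (data_weight_sym I sigma).

Definition gauss_kernel {R : realType} {d : nat} (sigma : R)
    (u : 'rV[R]_d) : R :=
  ((pi * sigma ^+ 2)^-1) `^ (d%:R / 2) * expR (- (norm2 u ^+ 2 / sigma ^+ 2)).

Definition kde {R : realType} {V : finType} {d : nat}
    (I : V -> 'rV[R]_d) (sigma : R) (S : {set V}) (c : 'rV[R]_d) : R :=
  #|S|%:R^-1 * \sum_(i in S) gauss_kernel sigma (I i - c).

(* Main.v *)
(** Completing the square, K(x - c) K(y - c) is, up to a positive constant C
    independent of x and y, the weight exp(- |x - y|^2 / (2 sigma^2)) times the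
    Gaussian density in c of mean (x + y) / 2 and standard deviation sigma / 2.
    Hence |S| |T| <g_S, g_T> = C * Cut(S, T) for all S and T; the theorem is then
    Cut(V, V) = Vol(A) + Vol(B) and Cut(S, V) = Vol(S), as the factors C and |S|
    cancel. *)
Require Import Defs.
From HB Require Import structures.
From mathcomp Require Import all_boot all_order all_algebra.
From mathcomp Require Import all_classical all_reals all_analysis.
From mathcomp Require Import measurable_realfun ring.
Import Order.TTheory GRing.Theory Num.Theory.
Import numFieldNormedType.Exports.
Local Open Scope ring_scope.

Set Implicit Arguments.
Unset Strict Implicit.

Lemma measurable_row_prod (R : realType) (n : nat)
    (f : 'I_n -> measurableTypeR R -> R) :
  (forall i, measurable_fun [set: measurableTypeR R] (f i)) ->
  measurable_fun [set: 'rV[R]_n] (fun x => \prod_(i < n) f i (x ord0 i)).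
Proof.
move=> mf; apply: measurable_prod => i _.
exact: (measurableT_comp (mf i) (measurable_row_coord i)).
Qed.

(** Tonelli, by induction on [n]: the measure on rows of length [n.+1] is the image under [row_cons]
    of a product measure, so the first coordinate splits off. *)
Lemma integral_lebesgue_row_prod (R : realType) (n : nat)
    (f : 'I_n -> measurableTypeR R -> R) :
  (forall i, measurable_fun [set: measurableTypeR R] (f i)) ->
  (forall i t, 0 <= f i t) ->
  (\int[lebesgue_row n]_x (\prod_(i < n) f i (x ord0 i))%:E =
   \prod_(i < n) \int[lebesgue_measure]_t (f i t)%:E)%E.
Proof.
elim: n f => [|n IHn] f mf f0.
  rewrite big_ord0 /=.
  under eq_integral do rewrite big_ord0.
  by rewrite integral_cst// mul1e /= diracT.
have mp := measurable_row_prod mf.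
have mp' : measurable_fun [set: 'rV[R]_n]
    (fun x => \prod_(i < n) f (lift ord0 i) (x ord0 i)).
  exact: (@measurable_row_prod _ _ (fun i => f (lift ord0 i))).
rewrite big_ord_recl -IHn// /= /lebesgue_cons.
rewrite ge0_integral_pushforward//=; last 2 first.
- exact/measurable_EFinP.
- by move=> x _; rewrite lee_fin prodr_ge0.
under eq_integral => p _.
  rewrite big_ord_recl row_cons0; under eq_bigr do rewrite row_consS.
  over.
rewrite preimage_setT fubini_tonelli1/=; last 2 first.
- apply/measurable_EFinP; apply: measurable_funM.
    exact: (measurableT_comp (mf ord0) measurable_fst).
  exact: (measurableT_comp mp' measurable_snd).
- by move=> p; rewrite lee_fin mulr_ge0 ?prodr_ge0.
(* The integral over the remaining coordinates is a constant; moving it under the integral over the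
   first one gives the iterated integral of the left side. *)
rewrite -ge0_integralZr//=; last 3 first.
- exact/measurable_EFinP.
- by move=> t _; rewrite lee_fin.
- by apply: integral_ge0 => x _; rewrite lee_fin prodr_ge0.
apply: eq_integral => t _; rewrite /fubini_F /=.
under eq_integral do rewrite EFinM.
rewrite ge0_integralZl_EFin//; last 2 first.
- by move=> x _; rewrite lee_fin prodr_ge0.
- exact/measurable_EFinP.
Qed.

Definition row_normal_pdf {R : realType} {d : nat} (m : 'rV[R]_d) (s : R)
    (c : 'rV[R]_d) : R :=
  \prod_(i < d) normal_pdf (m ord0 i) s (c ord0 i).

Lemma row_normal_pdf_ge0 (R : realType) (d : nat) (m : 'rV[R]_d) (s : R) c :
  0 <= row_normal_pdf m s c.
Proof. by apply: prodr_ge0 => i _; exact: normal_pdf_ge0. Qed.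

Lemma measurable_row_normal_pdf (R : realType) (d : nat) (m : 'rV[R]_d) (s : R) :
  measurable_fun [set: 'rV[R]_d] (row_normal_pdf m s).
Proof.
apply: (@measurable_row_prod _ _ (fun i => normal_pdf (m ord0 i) s)) => i.
exact: measurable_normal_pdf.
Qed.

Lemma integral_row_normal_pdf (R : realType) (d : nat) (m : 'rV[R]_d) (s : R) :
  (\int[lebesgue_row d]_c (row_normal_pdf m s c)%:E = 1)%E.
Proof.
rewrite (@integral_lebesgue_row_prod _ _ (fun i => normal_pdf (m ord0 i) s));
  last 2 first.
- by move=> i; exact: measurable_normal_pdf.
- by move=> i t; exact: normal_pdf_ge0.
by rewrite big1// => i _; exact: integral_normal_pdf.
Qed.

Lemma norm2_sqr (R : realType) (d : nat) (u : 'rV[R]_d) :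
  norm2 u ^+ 2 = \sum_(i < d) u ord0 i ^+ 2.
Proof. by rewrite sqr_sqrtr// sumr_ge0// => i _; exact: sqr_ge0. Qed.

(** The constant C of the overview: the squared prefactor of K over the peak of the Gaussian density
    of standard deviation [sigma / 2]. For [sigma > 0] it equals $(2\pi\sigma^2)^{-d/2}$. *)
Definition gauss_overlap {R : realType} (d : nat) (sigma : R) : R :=
  (((pi * sigma ^+ 2)^-1) `^ (d%:R / 2)) ^+ 2 / normal_peak (sigma / 2) ^+ d.

Lemma gauss_overlap_gt0 (R : realType) (d : nat) (sigma : R) :
  0 < sigma -> 0 < gauss_overlap d sigma.
Proof.
move=> s0; rewrite divr_gt0// exprn_gt0//.
  by rewrite powR_gt0// invr_gt0 mulr_gt0 ?pi_gt0 ?exprn_gt0.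
by rewrite normal_peak_gt0// gt_eqF// divr_gt0.
Qed.

(** The parallelogram law $\|x-c\|^2+\|y-c\|^2=\|x-y\|^2/2+2\|c-(x+y)/2\|^2$, divided by $-\sigma^2$
    and exponentiated. *)
Lemma gauss_kernelM (R : realType) (V : finType) (d : nat) (sigma : R)
    (I : V -> 'rV[R]_d) (i j : V) (c : 'rV[R]_d) : 0 < sigma ->
  gauss_kernel sigma (I i - c) * gauss_kernel sigma (I j - c) =
  gauss_overlap d sigma * data_weight I sigma i j *
    row_normal_pdf (2^-1 *: (I i + I j)) (sigma / 2) c.
Proof.
move=> s0; have sn0 : sigma != 0 by rewrite gt_eqF.
have s20 : sigma / 2 != 0 by rewrite gt_eqF// divr_gt0.
have pk0 : normal_peak (sigma / 2) != 0 by rewrite gt_eqF// normal_peak_gt0.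
rewrite /row_normal_pdf /data_weight /gauss_kernel /gauss_overlap.
under eq_bigr do rewrite normal_pdfE//.
rewrite big_split /= prodr_const card_ord /normal_fun -expR_sum.
rewrite mulrACA -expr2 -expRD [RHS]mulrACA divfK ?expf_neq0// -expRD.
(* The prefactors now agree, and the exponents are compared coordinate by coordinate. *)
congr (_ * expR _); rewrite !norm2_sqr !mulr_suml -!sumrN -!big_split /=.
apply: eq_bigr => k _; rewrite !mxE; field.
exact: sn0.
Qed.

(** The product of two estimates is a finite nonnegative combination of Gaussian densities, each of
    integral 1, so its integral is the sum of the coefficients. If [S] or [T] is empty, both sides
    are 0. *)
Lemma innerL2_kde (R : realType) (V : finType) (d : nat) (sigma : R)
    (I : V -> 'rV[R]_d) (S T : {set V}) : 0 < sigma ->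
  innerL2 (kde I sigma S) (kde I sigma T) =
  gauss_overlap d sigma * Cut (Gdata I sigma) S T / (#|S|%:R * #|T|%:R).
Proof.
move=> s0.
pose k : R := gauss_overlap d sigma / (#|S|%:R * #|T|%:R).
pose w i j := k * data_weight I sigma i j.
pose phi i j := row_normal_pdf (2^-1 *: (I i + I j)) (sigma / 2).
have w0 i j : 0 <= w i j.
  have C0 := ltW (gauss_overlap_gt0 d s0).
  by rewrite mulr_ge0 ?expR_ge0// divr_ge0// mulr_ge0.
have kdeM c : kde I sigma S c * kde I sigma T c =
    \sum_(i in S) \sum_(j in T) w i j * phi i j c.
  rewrite /kde mulrACA -invfM big_distrlr /= mulr_sumr; apply: eq_bigr => i _.
  rewrite mulr_sumr; apply: eq_bigr => j _.
  by rewrite gauss_kernelM// /w /k /phi; ring.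
have mphi i j : measurable_fun [set: 'rV[R]_d] (fun c => (w i j * phi i j c)%:E).
  apply/measurable_EFinP/measurable_funM => //.
  exact: measurable_row_normal_pdf.
have phi0 i j c : (0 <= (w i j * phi i j c)%:E)%E.
  by rewrite lee_fin mulr_ge0// row_normal_pdf_ge0.
have intphi i j : (\int[lebesgue_row d]_c (w i j * phi i j c)%:E = (w i j)%:E)%E.
  under eq_integral do rewrite EFinM.
  rewrite ge0_integralZl_EFin ?integral_row_normal_pdf ?mule1//.
  - by move=> c _; rewrite lee_fin row_normal_pdf_ge0.
  - apply/measurable_EFinP; exact: measurable_row_normal_pdf.
(* The double sum becomes a sum over one list of pairs, the form in which sum and integral are
   exchanged. *)
pose r := [seq p : V * V <- index_enum _ | (p.1 \in S) && (p.2 \in T)].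
rewrite /innerL2 /Rintegral.
under eq_integral => c _.
  rewrite kdeM pair_big -big_filter -/r -sumEFin.
  over.
rewrite (ge0_integral_sum _ _ (f := fun p c => (w p.1 p.2 * phi p.1 p.2 c)%:E))//.
under eq_bigr do rewrite intphi.
rewrite sumEFin /= big_filter -(pair_big (mem S) (mem T) w) /= /Cut mulrAC mulr_sumr.
by apply: eq_bigr => i _; rewrite mulr_sumr.
Qed.

Lemma CutT (R : realType) (V : finType) (G : wgraph R V) (S : {set V}) :
  Cut G S [set: V] = Vol G S.
Proof. by apply: eq_bigr => i _; apply: eq_bigl => j; rewrite inE. Qed.

Lemma VolT_partition (R : realType) (V : finType) (G : wgraph R V)
    (A B : {set V}) : [disjoint A & B] -> A :|: B = [set: V] ->
  Vol G [set: V] = Vol G A + Vol G B.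
Proof.
move=> dAB cAB; rewrite -cAB /Vol -bigU//.
by apply: eq_bigl => i; rewrite !inE.
Qed.

(** All weights are nonnegative, and the diagonal weight of any vertex of [S] is positive. This
    makes the denominators of [NCut] nonzero. *)
Lemma Vol_Gdata_gt0 (R : realType) (V : finType) (d : nat)
    (I : V -> 'rV[R]_d) (sigma : R) (S : {set V}) :
  S != finset.set0 -> 0 < Vol (Gdata I sigma) S.
Proof.
case/set0Pn => i iS; rewrite /Vol.
have w0 j k : 0 <= data_weight I sigma j k by exact: expR_ge0.
rewrite (bigD1 i)//=; apply: ltr_pwDl; last first.
  by do 2![apply: sumr_ge0 => ? _].
rewrite (bigD1 i)//=; apply: ltr_pwDl; first exact: expR_gt0.
by apply: sumr_ge0 => ? _.
Qed.

Unset Implicit Arguments.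
Set Strict Implicit.

Theorem proposition2 (R : realType) (V : finType) (d : nat) (hd : (1 <= d)%N)
    (I : V -> 'rV[R]_d) (sigma : R) (hsigma : 0 < sigma)
    (A B : {set V}) (hA : A != finset.set0) (hB : B != finset.set0)
    (hdisj : [disjoint A & B]) (hcover : A :|: B = [set: V]) :
  let g := kde I sigma in
  NCut (Gdata I sigma) A B =
    innerL2 (g [set: V]) (g [set: V]) *
      (innerL2 (g A) (g B) /
        (innerL2 (g A) (g [set: V]) * innerL2 (g B) (g [set: V]))).
Proof.
move=> g; rewrite !innerL2_kde// !CutT (VolT_partition _ hdisj hcover) /NCut.
have card0 (S : {set V}) : S != finset.set0 -> (#|S|%:R : R) != 0.
  by move=> S0; rewrite pnatr_eq0 cards_eq0.
have hV : [set: V] != finset.set0.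
  by case/set0Pn: hA => i _; apply/set0Pn; exists i; rewrite inE.
have C0 := lt0r_neq0 (gauss_overlap_gt0 d hsigma).
have vA := lt0r_neq0 (Vol_Gdata_gt0 I sigma hA).
have vB := lt0r_neq0 (Vol_Gdata_gt0 I sigma hB).
(* What remains is $c/a+c/b=(a+b)c/(ab)$ with $c$ the cut and $a,b$ the two volumes, once the
   overlap constants and cardinals cancel. *)
by field; rewrite !card0// C0 vA vB.
Qed.
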